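(* Let $r \ge 2$ and $s \ge 3$ be integers, let $b_i = i(s-1)+1$ for $i \in \{1,\dots,r-1\}$, and let $B=\prod_{i=1}^{r-1} b_i$. Then $F^{\chi}(r, s, s+1)$ exists and $$F^{\chi}(r, s, s+1) \leq 1+s+ \sum_{i=2}^{r-1} F^{\chi}(i,s,s+1) + B \cdot F^{\chi}(r,s-1,s).$$ In particular, for all $s \geq 3$, the number $F^{\chi}(2, s, s+1)$ exists and $F^{\chi}(2, s, s+1) \leq 1 + s + s\,F^{\chi}(2, s-1 , s)$.
   Context: All graphs are finite, undirected, loopless and simple. $cl(G)$ is the clique number of $G$ and $\chi(G)$ its chromatic number. For integers $r\ge 2$ and $a_1,\dots,a_r\ge 2$, write $G \rightarrow (a_1,\dots,a_r)^v$ if for every coloring of the vertex set $V(G)$ with $r$ colors $1,\dots,r$ there is some color $i\in\{1,\dots,r\}$ such that $G$ contains a clique $K_{a_i}$ all of whose vertices have color $i$. For integers $r\ge2$, $a\ge 2$ and $t>a$, let $\mathcal{F}^{\chi}(r,a,t)$ be the set of graphs $G$ such that $G\rightarrow (a,\dots,a)^v$ (with $a$ repeated $r$ times), $cl(G)<t$ (i.e. $G$ is $K_t$-free), and $\chi(G)=r(a-1)+1$. The diagonal chromatic vertex Folkman number is $F^{\chi}(r,a,t)=\min\{|V(G)| : G\in\mathcal{F}^{\chi}(r,a,t)\}$; it is said to exist if $\mathcal{F}^{\chi}(r,a,t)$ is nonempty. An empty sum equals $0$. *)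

(* Defs.v *)
From HB Require Import structures.
From mathcomp Require Import all_boot.
From mathcomp Require Import boolp classical_sets.

Set Implicit Arguments.
Unset Strict Implicit.
Unset Printing Implicit Defensive.

Local Open Scope classical_set_scope.

Record sgraph := SGraph {
  vertex :> finType;
  adj : rel vertex;
  adj_sym : symmetric adj;
  adj_irr : irreflexive adj
}.

Definition clique (G : sgraph) (S : {set G}) : bool :=
  [forall x in S, forall y in S, (x != y) ==> adj x y].

Definition clique_number (G : sgraph) : nat :=
  \max_(S : {set G} | clique S) #|S|.

Definition colorable (G : sgraph) (k : nat) : bool :=
  [exists c : {ffun G -> 'I_k}, forall x, forall y, adj x y ==> (c x != c y)].

Lemma colorable_ex (G : sgraph) : exists k, colorable G k.
Proof.
exists #|G|; apply/existsP; exists [ffun x => enum_rank x].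
apply/forallP => x; apply/forallP => y; apply/implyP => xy.
rewrite !ffunE; apply/eqP => /enum_rank_inj exy.
by move: xy; rewrite exy adj_irr.
Qed.

Definition chromatic_number (G : sgraph) : nat := ex_minn (colorable_ex G).

(* [arrow G a] is G -> (a_1, ..., a_r)^v; the colors are the elements of 'I_r,
   and the colorings are arbitrary, not necessarily proper. *)
Definition arrow (G : sgraph) (r : nat) (a : 'I_r -> nat) : bool :=
  [forall c : {ffun G -> 'I_r}, exists i : 'I_r, exists S : {set G},
     [&& clique S, #|S| == a i & [forall x in S, c x == i]]].

Definition folkman_family (r a t : nat) (G : sgraph) : Prop :=
  [/\ arrow G (fun _ : 'I_r => a),
      clique_number G < t
    & chromatic_number G = r * (a - 1) + 1].

Definition folkman_exists (r a t : nat) : Prop :=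
  exists G, folkman_family r a t G.

(* The least order of a graph of the family; the default value 0 is only taken
   when the family is empty. *)
Definition folkman (r a t : nat) : nat :=
  xget 0 [set n | (exists2 G : sgraph, folkman_family r a t G & #|G| = n) /\
                  (forall G : sgraph, folkman_family r a t G -> n <= #|G|)].

(* Main.v *)
(** A Zykov-type construction.  Take graphs [G_i] in F^chi(i,s,s+1) for
    0 <= i < r, where [G_0 = K_1] and [G_1 = K_s] are allowed, each split into
    the [b_i = i(s-1)+1] classes of a proper coloring.  For every choice of one
    class in each [G_i], add a copy of a graph [H] of F^chi(r,s-1,s) joined to
    the chosen classes.  In an [r]-coloring without monochromatic [K_s], [G_i]
    meets more than [i] colors, so vertices [v_i] of [G_i] with pairwise
    distinct colors can be picked greedily; the copy of [H] attached to their
    classes has a monochromatic [K_(s-1)], which some [v_i] extends to [K_s].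
    Coloring the [G_i] with the same [r(s-1)+1] colors, each copy of [H] has to
    avoid only [r] of them, and [r(s-2)+1] remain.  Starting from the one-vertex
    graph, which lies in F^chi(r,1,2), all the families are nonempty. *)
Require Import Defs.
From mathcomp Require Import all_boot.
From mathcomp Require Import boolp.
From mathcomp Require classical_sets.
From mathcomp Require Import zify.

Set Implicit Arguments.
Unset Strict Implicit.
Unset Printing Implicit Defensive.

(** * Reflection lemmas and the lower bound on the chromatic number *)

Lemma cliqueP (G : sgraph) (S : {set G}) :
  reflect {in S &, forall x y, x != y -> adj x y} (clique S).
Proof.
apply: (iffP idP) => [/forall_inP h x y xS yS xy|h].
  by have /forall_inP/(_ y yS)/implyP := h x xS; apply.
apply/forall_inP => x xS; apply/forall_inP => y yS; apply/implyP; exact: h.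
Qed.

Lemma clique_number_ltP (G : sgraph) (t : nat) :
  reflect (forall S : {set G}, clique S -> #|S| <= t) (clique_number G < t.+1).
Proof. by rewrite ltnS; apply: bigmax_leqP. Qed.

Lemma colorableP (G : sgraph) (k : nat) :
  reflect (exists c : G -> 'I_k, forall x y, adj x y -> c x != c y)
          (colorable G k).
Proof.
apply: (iffP existsP) => [[c /forallP h]|[c h]].
  by exists c => x y xy; have /forallP/(_ y)/implyP := h x; apply.
exists (finfun c); apply/forallP => x; apply/forallP => y; apply/implyP.
by rewrite !ffunE; apply: h.
Qed.

Lemma arrowP (G : sgraph) (r : nat) (a : 'I_r -> nat) :
  reflect (forall c : G -> 'I_r, exists i (S : {set G}),
             [/\ clique S, #|S| = a i & {in S, forall x, c x = i}])
          (arrow G a).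
Proof.
apply: (iffP forallP) => h c.
  have /existsP[i /existsP[S /and3P[Sc /eqP Sa /forall_inP Si]]] := h (finfun c).
  by exists i, S; split=> // x xS; have /eqP := Si x xS; rewrite ffunE.
have [i [S [Sc Sa Si]]] := h c.
apply/existsP; exists i; apply/existsP; exists S; rewrite Sc Sa eqxx /=.
by apply/forall_inP => x xS; rewrite Si.
Qed.

(* Merging the colors of a proper coloring into [r] blocks of [a - 1] colors
   leaves no monochromatic clique of order [a]. *)
Lemma arrow_chromatic_number (G : sgraph) (r a : nat) : 0 < a ->
  arrow G (fun _ : 'I_r => a) -> r * (a - 1) < chromatic_number G.
Proof.
move=> a0 /arrowP Ga; rewrite /chromatic_number; case: ex_minnP => k.
move=> /colorableP[c cP] _; rewrite ltnNge; apply/negP => kr.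
have cr x : c x < r * (a - 1) by apply: leq_trans kr.
(* A vertex has a color below [r * (a - 1)], so this product is nonzero. *)
have a1 (x : G) : 0 < a - 1 by have := cr x; case: (a - 1); rewrite ?muln0.
have dr x : c x %/ (a - 1) < r by rewrite ltn_divLR ?(a1 x).
have [i [S [/cliqueP Sc Sa Si]]] := Ga (fun x => Ordinal (dr x)).
(* The quotient is the block and the remainder the place in it. On the clique [S], contained in one
   block, remainders are distinct, so [a] vertices would need [a] of the [a - 1] remainders. *)
have mr x : c x %% (a - 1) < a - 1 by rewrite ltn_mod (a1 x).
have inj : {in S &, injective (fun x => Ordinal (mr x))}.
  move=> x y xS yS /(congr1 val) /= exy; apply/eqP; apply/negPn/negP => nxy.
  have /eqP := cP x y (Sc x y xS yS nxy); apply; apply: val_inj => /=.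
  rewrite (divn_eq (c x) (a - 1)) (divn_eq (c y) (a - 1)) exy.
  by have := Si y yS; rewrite -(Si x xS) => /(congr1 val) /= ->.
have := max_card [set Ordinal (mr x) | x in S].
by rewrite card_in_imset // card_ord Sa; lia.
Qed.

(** Arrowing already forces the lower bound on the chromatic number, so a coloring with that many
    colors suffices. *)
Lemma folkman_familyP (G : sgraph) (r a t : nat) : 0 < a ->
  folkman_family r a t.+1 G <->
  [/\ arrow G (fun _ : 'I_r => a),
      forall S : {set G}, clique S -> #|S| <= t
    & colorable G (r * (a - 1) + 1)].
Proof.
move=> a0; split=> [[Ga /clique_number_ltP Gt Gc]|[Ga Gt Gc]]; split=> //.
- by rewrite -Gc /chromatic_number; case: ex_minnP.
- exact/clique_number_ltP.
have := arrow_chromatic_number a0 Ga; rewrite -addn1 => lb.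
apply/eqP; rewrite eqn_leq lb andbT /chromatic_number.
by case: ex_minnP => k _; apply.
Qed.

(** * Complete graphs: the starting members of the families *)

Section CompleteGraph.
Variable n : nat.

Let complete_adj : rel 'I_n := fun x y => x != y.

Let complete_sym : symmetric complete_adj.
Proof. by move=> x y; rewrite /complete_adj eq_sym. Qed.

Let complete_irr : irreflexive complete_adj.
Proof. by move=> x; rewrite /complete_adj eqxx. Qed.

Definition complete_graph : sgraph := SGraph complete_sym complete_irr.

Lemma complete_graph_clique (S : {set complete_graph}) : clique S.
Proof. by apply/cliqueP. Qed.

Lemma card_complete_graph_set (S : {set complete_graph}) : #|S| <= n.
Proof. by rewrite -[X in _ <= X](card_ord n); apply: max_card. Qed.

Lemma complete_graph_colorable : colorable complete_graph n.
Proof. by apply/colorableP; exists id. Qed.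

End CompleteGraph.

(** Arrowing holds vacuously: a nonempty graph has no coloring with zero colors. *)
Lemma K1_family0 (a : nat) : 0 < a -> folkman_family 0 a a.+1 (complete_graph 1).
Proof.
move=> a0; apply/folkman_familyP => //; split.
- by apply/arrowP => c; case: (c ord0).
- by move=> S _; apply: leq_trans a0; apply: card_complete_graph_set.
- exact: complete_graph_colorable.
Qed.

Lemma Ka_family1 (a : nat) : 0 < a -> folkman_family 1 a a.+1 (complete_graph a).
Proof.
move=> a0; apply/folkman_familyP => //; split.
- apply/arrowP => c; exists ord0, [set: 'I_a]; split.
  + exact: complete_graph_clique.
  + by rewrite cardsT card_ord.
  + by move=> x _; rewrite ord1.
- by move=> S _; apply: card_complete_graph_set.
- by rewrite mul1n subnK //; apply: complete_graph_colorable.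
Qed.

Lemma K1_family (r : nat) : folkman_family r 1 2 (complete_graph 1).
Proof.
apply/folkman_familyP => //; split.
- apply/arrowP => c; exists (c ord0), [set ord0]; split.
  + exact: complete_graph_clique.
  + by rewrite cards1.
  + by move=> x _; rewrite ord1.
- by move=> S _; apply: card_complete_graph_set.
- by rewrite subnn muln0; apply: complete_graph_colorable.
Qed.

(** * The Zykov-type graph and its order *)

Section Zykov.
Variables (r : nat) (b : 'I_r -> nat) (G : 'I_r -> sgraph) (H : sgraph).
Variable c : forall i, G i -> 'I_(b i).

(** A dependent function [f] selects one class in each [G i]; the pair [(f, h)] is the vertex [h] in
    the copy of [H] attached to that selection. *)
Definition zykov_vertex : finType :=
  ({i : 'I_r & G i} + {dffun forall i, 'I_(b i)} * H)%type.

Definition zykov_adj : rel zykov_vertex := fun x y =>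
  match x, y with
  | inl u, inl v => (tag u == tag v) && adj (tagged u) (tagged_as u v)
  | inl u, inr p => p.1 (tag u) == c (tagged u)
  | inr p, inl u => p.1 (tag u) == c (tagged u)
  | inr p, inr q => (p.1 == q.1) && adj p.2 q.2
  end.

Lemma zykov_sym : symmetric zykov_adj.
Proof.
move=> [u|p] [v|q] //=; last by rewrite eq_sym adj_sym.
case: u v => [i x] [j y] /=; rewrite eq_sym.
by case: eqVneq => // ij; subst j; rewrite !tagged_asE adj_sym.
Qed.

Lemma zykov_irr : irreflexive zykov_adj.
Proof. by move=> [[i x]|p] /=; rewrite ?tagged_asE adj_irr andbF. Qed.

Definition zykov : sgraph := SGraph zykov_sym zykov_irr.

Definition base (i : 'I_r) (x : G i) : zykov := inl (Tagged G x).
Definition copy (f : {dffun forall i, 'I_(b i)}) (h : H) : zykov := inr (f, h).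

Lemma base_inj i : injective (@base i).
Proof. by move=> x y [] /eqP; rewrite eq_Tagged => /eqP. Qed.

Lemma copy_inj f : injective (copy f).
Proof. by move=> x y []. Qed.

Lemma adj_base i (x y : G i) : adj (base x) (base y) = adj x y.
Proof. by rewrite /= eqxx tagged_asE. Qed.

Lemma adj_copy f (x y : H) : adj (copy f x) (copy f y) = adj x y.
Proof. by rewrite /= eqxx. Qed.

Lemma card_zykov : #|zykov| = \sum_(i < r) #|G i| + (\prod_(i < r) b i) * #|H|.
Proof.
rewrite card_sum card_tagged card_prod card_dep_ffun.
congr (_ + _ * _).
  by rewrite sumnE big_map big_enum.
rewrite foldrE big_map big_enum.
by apply: eq_bigr => i _; rewrite card_ord.
Qed.

Section Image.
Variables (K L : sgraph) (e : K -> L).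
Hypothesis e_inj : injective e.
Hypothesis e_adj : forall x y, adj (e x) (e y) = adj x y.

Lemma clique_imset (S : {set K}) : clique S -> clique [set e x | x in S].
Proof.
move=> /cliqueP Sc; apply/cliqueP => _ _ /imsetP[x xS ->] /imsetP[y yS ->].
by rewrite (inj_eq e_inj) e_adj; apply: Sc.
Qed.

Lemma clique_preimset (S : {set L}) : clique S -> clique (e @^-1: S).
Proof.
move=> /cliqueP Sc; apply/cliqueP => x y; rewrite !inE => xS yS xy.
by rewrite -e_adj; apply: Sc; rewrite ?(inj_eq e_inj).
Qed.

Lemma card_preimset_range (S : {set L}) :
  {in S, forall y, exists x, y = e x} -> #|S| <= #|e @^-1: S|.
Proof.
move=> Se; rewrite -(card_imset _ e_inj); apply/subset_leq_card/subsetP => y yS.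
have [x yx] := Se y yS; apply/imsetP; exists x => //.
by rewrite inE -yx.
Qed.

End Image.

(** * Clique bound, coloring and arrowing of the construction *)

Hypothesis c_proper : forall i (x y : G i), adj x y -> c x != c y.

(** A clique meeting a copy of [H] stays within that copy except for at most one base vertex; any
    other clique lies in a single [G i]. *)
Lemma zykov_clique (a : nat) :
  (forall i (S : {set G i}), clique S -> #|S| <= a.+1) ->
  (forall S : {set H}, clique S -> #|S| <= a) ->
  forall S : {set zykov}, clique S -> #|S| <= a.+1.
Proof.
move=> Ga Ha S Sc; have /cliqueP Sadj := Sc.
have [[[f h] hS]|noR] := pselect (exists p, inr p \in S).
  have Sr q : inr q \in S -> q.1 = f.
    move=> qS; have [[->]//|ne] := eqVneq (inr q : zykov) (inr (f, h)).
    by have /andP[/eqP] := Sadj _ _ qS hS ne.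
  pose L := [set x in S | if x is inl _ then true else false].
  pose R := S :\: L.
  have L1 : #|L| <= 1.
    apply/card_le1_eqP => -[u|p] [v|q]; rewrite !inE ?andbT ?andbF // => uS vS.
    apply/eqP/negPn/negP; rewrite eq_sym => ne.
    have /andP[/eqP] := Sadj _ _ uS vS ne.
    have /eqP := Sadj _ _ uS hS isT; have /eqP := Sadj _ _ vS hS isT.
    (* Both base vertices are joined to copy [f], so they share the class [f i], against properness
       of [c]. *)
    case: u v {uS vS ne} => [i x] [j y] /= ey ex ij; subst j.
    by rewrite tagged_asE => /c_proper; rewrite -ex -ey eqxx.
  have Ra : #|R| <= a.
    apply: leq_trans (Ha (copy f @^-1: R) _).
      apply: (card_preimset_range (@copy_inj f)) => -[u|q].
        by rewrite !inE andbT; case: (_ \in S).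
      rewrite !inE => /andP[_ qS]; exists q.2.
      by rewrite /copy -(Sr q qS); case: (q).
    apply: (clique_preimset (@copy_inj f) (@adj_copy f)).
    by apply/cliqueP => x y /setDP[xS _] /setDP[yS _]; apply: Sadj.
  by rewrite -(cardsID L S) -addn1 addnC leq_add // (leq_trans _ L1) //
             subset_leq_card // subsetIr.
have [->|[[[i x]|p] xS]] := set_0Vmem S; first by rewrite cards0.
  apply: leq_trans (Ga i (@base i @^-1: S) _); last first.
    exact: (clique_preimset (@base_inj i) (@adj_base i)).
  apply: (card_preimset_range (@base_inj i)) => -[v|q] vS; last first.
    by case: noR; exists q.
  have [->|ne] := eqVneq (inl v : zykov) (base x); first by exists x.
  have := Sadj _ _ vS xS ne; case: v {vS ne} => [j y] /= /andP[/eqP ij _].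
  by subst j; exists y.
by case: noR; exists p.
Qed.

Lemma zykov_colorable (m N : nat) :
  colorable H m -> (forall i, b i <= N) -> m + r <= N -> colorable zykov N.
Proof.
move=> /colorableP[d dP] bN mN; apply/colorableP.
pose w i (q : 'I_(b i)) : 'I_N := widen_ord (bN i) q.
(* The colors seen by copy [f] on its base neighbors: at most [r], so [m] of the [N] remain for
   [H]. *)
pose A (f : {dffun forall i, 'I_(b i)}) := [set w i (f i) | i in 'I_r].
have cA f : m <= #|~: A f|.
  have := cardsC (A f); rewrite card_ord => NE.
  have : #|A f| <= r by rewrite -[X in _ <= X]card_ord leq_imset_card.
  lia.
pose e f (q : 'I_m) : 'I_N := enum_val (widen_ord (cA f) q).
have eA f q : e f q \notin A f by rewrite -in_setC; apply: enum_valP.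
have e_inj f : injective (e f).
  by move=> p q /enum_val_inj /(congr1 val) pq; apply: val_inj.
pose k (x : zykov) : 'I_N :=
  match x with inl u => w _ (c (tagged u)) | inr p => e p.1 (d p.2) end.
have mixed u p : zykov_adj (inl u) (inr p) -> k (inl u) != k (inr p).
  move=> /= /eqP up; apply: contraNneq (eA p.1 (d p.2)) => /= <-.
  by apply/imsetP; exists (tag u); rewrite ?up.
exists k => -[u|p] [v|q].
- case: u v => [i x] [j y] /= /andP[/eqP ij]; subst j.
  rewrite tagged_asE => /c_proper; apply: contra_neq => /(congr1 val) /= xy.
  exact: val_inj.
- exact: mixed.
- by move=> pv; rewrite eq_sym; apply: mixed; rewrite /= in pv *.
- case: p q => [f h] [g h'] /= /andP[/eqP <-] /dP; apply: contra_neq.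
  exact: e_inj.
Qed.

Lemma greedy_transversal (k : zykov -> 'I_r) :
  (forall (i : 'I_r) (D : {set 'I_r}), #|D| <= i ->
     exists x : G i, k (base x) \notin D) ->
  exists v : forall i, G i, injective (fun i => k (base (v i))).
Proof.
move=> new.
suff main n : n <= r -> exists v : forall i, G i, forall i j : 'I_r,
    i < j < n -> k (base (v i)) != k (base (v j)).
  have [v vP] := main r (leqnn r); exists v => i j /eqP; apply: contraTeq; rewrite neq_ltn.
  by case/orP=> ij; [|rewrite eq_sym]; apply: vP; rewrite ij ltn_ord.
elim: n => [_|n IH nr].
  (* The empty [D] shows each [G i] nonempty, giving an arbitrary initial choice that the induction
     then corrects one index at a time. *)
  have ne i : exists x : G i, true.
    by have [|x _] := new i set0; [rewrite cards0|exists x].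
  by exists (fun i => xchoose (ne i)) => i j; rewrite ltn0 andbF.
have [v vP] := IH (ltnW nr).
pose i0 := Ordinal nr.
have [|x xD] := new i0 [set k (base (v (widen_ord (ltnW nr) j))) | j in 'I_n].
  by apply: leq_trans (leq_imset_card _ _) _; rewrite card_ord.
exists (dfwith v x) => i j /andP[ij]; rewrite ltnS leq_eqVlt => jn.
have i0i : i0 != i.
  by apply/eqP => /(congr1 val) /= ni; move: jn; rewrite -ni in ij; lia.
rewrite (dfwith_out _ _ i0i).
case/orP: jn => [/eqP jn|jn].
  have <- : i0 = j by apply: val_inj.
  rewrite dfwith_in; apply: contraNneq xD => <-; rewrite jn in ij.
  apply/imsetP; exists (Ordinal ij) => //.
  by congr (k (base (v _))); apply: val_inj.
have i0j : i0 != j by apply/eqP => /(congr1 val) /= nj; move: jn; rewrite -nj ltnn.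
by rewrite (dfwith_out _ _ i0j); apply: vP; rewrite ij.
Qed.

Lemma zykov_arrow (a : nat) :
  (forall i : 'I_r, arrow (G i) (fun _ : 'I_i => a.+1)) ->
  arrow H (fun _ : 'I_r => a) ->
  arrow zykov (fun _ : 'I_r => a.+1).
Proof.
move=> Ga /arrowP Ha; apply/arrowP => k; apply: contrapT => mono.
have [|v v_inj] := @greedy_transversal k.
  (* If [G i] used only colors of [D], renumbering them by their index in [enum D] would give a
     coloring with [i] colors, hence a monochromatic clique of order [a.+1]. *)
  move=> i D Di; apply: contrapT => /forallNP kD.
  have {}kD (x : G i) : k (base x) \in D by apply/negPn/negP.
  have lt (x : G i) : index (k (base x)) (enum D) < i.
    by apply: leq_trans Di; rewrite cardE index_mem mem_enum.
  have /arrowP/(_ (fun x => Ordinal (lt x)))[q [S [Sc Sa Sq]]] := Ga i.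
  have /card_gt0P[x0 x0S] : 0 < #|S| by rewrite Sa.
  apply: mono; exists (k (base x0)), [set base x | x in S]; split.
  - exact: (clique_imset (@base_inj i) (@adj_base i)).
  - by rewrite card_imset //; apply: base_inj.
  - move=> _ /imsetP[x xS ->].
    have := Sq x xS; rewrite -(Sq x0 x0S).
    move=> /(congr1 val) /= /(congr1 (nth (k (base x0)) (enum D))).
    by rewrite !nth_index ?mem_enum.
pose f : {dffun forall i, 'I_(b i)} := [ffun i => c (v i)].
have [q [S [Sc Sa Sq]]] := Ha (fun h => k (copy f h)).
(* The colors of the [r] chosen vertices are distinct, so all [r] colors occur; [i] is the index
   whose vertex has color [q]. *)
have [g _ gK] := injF_bij v_inj; pose i := g q.
have vi : base (v i) \notin [set copy f h | h in S] by apply/imsetP => -[].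
have vadj h : adj (base (v i)) (copy f h) by rewrite /= ffunE.
apply: mono; exists q, (base (v i) |: [set copy f h | h in S]); split.
- have /cliqueP Tc := clique_imset (@copy_inj f) (@adj_copy f) Sc.
  apply/cliqueP => x y /setU1P[->|xS] /setU1P[->|yS]; rewrite ?eqxx //.
  + by case/imsetP: yS => h _ ->.
  + by case/imsetP: xS => h _ ->; rewrite adj_sym.
  + exact: Tc.
- by rewrite cardsU1 vi card_imset ?Sa //; apply: copy_inj.
- by move=> x /setU1P[->|/imsetP[h hS ->]]; [apply: gK|apply: Sq].
Qed.

End Zykov.

(** * Existence and the recursive bound for Folkman numbers *)

Lemma folkman_zykov (r a : nat) (G : 'I_r -> sgraph) (H : sgraph) : 0 < a ->
  (forall i : 'I_r, folkman_family i a.+1 a.+2 (G i)) ->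
  folkman_family r a a.+1 H ->
  exists2 X : sgraph, folkman_family r a.+1 a.+2 X
    & #|X| = \sum_(i < r) #|G i| + (\prod_(i < r) (i * a + 1)) * #|H|.
Proof.
move=> a0 GF /(folkman_familyP _ _ _ a0) [Ha Ht Hc].
have {}GF i := (folkman_familyP (G i) i a.+1 (ltn0Sn a)).1 (GF i).
have col i : {c : {ffun G i -> 'I_(i * a + 1)} |
    [forall x, forall y, adj x y ==> (c x != c y)]}.
  by apply: sigW; apply/existsP; have [_ _] := GF i; rewrite subn1.
pose c i (x : G i) := sval (col i) x.
have c_proper i (x y : G i) : adj x y -> c i x != c i y.
  by move: (svalP (col i)) => /forallP/(_ x)/forallP/(_ y)/implyP; apply.
exists (zykov H c); last exact: card_zykov.
apply/folkman_familyP => //; split.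
- by apply: zykov_arrow => // i; case: (GF i).
- by apply: zykov_clique => // i; case: (GF i).
- rewrite subn1 /=; apply: (zykov_colorable c_proper Hc) => [i|].
    by rewrite leq_add2r leq_mul2r ltnW ?orbT.
  (* The count is [r * (a - 1) + 1 + r = r * a + 1], which needs [a] positive. *)
  case: a a0 {GF col c c_proper Ha Ht Hc} => // a _.
  by rewrite subn1 /= mulnS; lia.
Qed.

Lemma folkman_min (r a t : nat) (G : sgraph) :
  folkman_family r a t G -> folkman r a t <= #|G|.
Proof.
move=> GF; rewrite /folkman; case: classical_sets.xgetP => [n _ [_]|//]; exact.
Qed.

Lemma folkman_attained (r a t : nat) : folkman_exists r a t ->
  exists2 G, folkman_family r a t G & #|G| = folkman r a t.
Proof.
move=> [G0 G0F].
pose P n := `[< exists2 G, folkman_family r a t G & #|G| = n >].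
have exP : exists n, P n by exists #|G0|; apply/asboolP; exists G0.
have [n /asboolP nP nmin] := ex_minnP exP.
(* The least order [n] satisfies the defining predicate, which rules out the default value of
   [xget]. *)
rewrite /folkman; case: classical_sets.xgetP => [m _ [mP _]//|/(_ n)[]].
by split=> // G GF; apply: nmin; apply/asboolP; exists G.
Qed.

(** Induction on [a] supplies [H]; inside it, strong induction on [r] supplies the graphs [G i],
    including the case [i = 0]. *)
Lemma folkman_exists_all (r a : nat) : 0 < a -> folkman_exists r a a.+1.
Proof.
case: a => // a _; elim: a r => [|a IHa] r.
  by exists (complete_graph 1); apply: K1_family.
elim/ltn_ind: r => r IHr.
have [G GF] := choice (fun i : 'I_r => IHr i (ltn_ord i)).
have [H HF] := IHa r.
by have [X XF _] := folkman_zykov (ltn0Sn a) GF HF; exists X.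
Qed.

Lemma folkman_le (r a : nat) : 0 < a -> 1 < r ->
  folkman r a.+1 a.+2 <=
    1 + a.+1 + \sum_(2 <= i < r) folkman i a.+1 a.+2
    + (\prod_(1 <= i < r) (i * a + 1)) * folkman r a a.+1.
Proof.
move=> a0 r1.
have att (i : 'I_r) : exists G, folkman_family i a.+1 a.+2 G /\
    #|G| = folkman i a.+1 a.+2.
  have [G] := folkman_attained (folkman_exists_all i (ltn0Sn a)).
  by exists G.
have [G GF] := choice att.
have [H HF HE] := folkman_attained (folkman_exists_all r a0).
have [X XF XE] := folkman_zykov a0 (fun i => (GF i).1) HF.
apply: leq_trans (folkman_min XF) _.
rewrite {}XE {}HE (eq_bigr _ (fun i _ => (GF i).2)).
rewrite -(big_mkord xpredT (fun i => folkman i a.+1 a.+2)).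
rewrite -(big_mkord xpredT (fun i => i * a + 1)).
(* The terms of index 0 and 1 are split off the sum, to be bounded by the orders of [K_1] and
   [K_(a+1)]; the factor of index 0 is 1. *)
rewrite !(big_ltn (ltnW r1)) (big_ltn r1) mul0n add0n mul1n leq_add2r.
rewrite addnA leq_add2r.
have := folkman_min (K1_family0 (ltn0Sn a)).
have := folkman_min (Ka_family1 (ltn0Sn a)).
by rewrite !card_ord => h1 h0; apply: leq_add.
Qed.

Theorem theorem3 :
  (forall r s : nat, 2 <= r -> 3 <= s ->
     folkman_exists r s (s + 1) /\
     folkman r s (s + 1) <=
       1 + s + \sum_(2 <= i < r) folkman i s (s + 1)
       + (\prod_(1 <= i < r) (i * (s - 1) + 1)) * folkman r (s - 1) s)
  /\
  (forall s : nat, 3 <= s ->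
     folkman_exists 2 s (s + 1) /\
     folkman 2 s (s + 1) <= 1 + s + s * folkman 2 (s - 1) s).
Proof.
split=> [r [|s] // r2 s2|[|s] // s2]; rewrite addn1 subn1 /=.
  split; first exact: folkman_exists_all.
  by apply: folkman_le => //; rewrite -ltnS ltnW.
split; first exact: folkman_exists_all.
(* For [r = 2] the sum is empty and the product is the single factor [1 * s + 1]. *)
have := @folkman_le 2 s; rewrite big_geq // big_nat1 mul1n addn0 addn1.
by apply=> //; rewrite -ltnS ltnW.
Qed.
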